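(* Let $n_x,n_y\ge2$, $N=n_xn_y$, and let $\mathbf{H}$, $\mathbf{P}_\perp$ (with zero boundary data) and $\mathbf{P}_\parallel$ be as in the context. Let $\mathbf{f}\in\mathbb{R}^N$ and let $\mathbf{u}:[0,\infty)\to\mathbb{R}^N$ be a solution of the semi-discrete field aligned anisotropic diffusion equation (with zero source) $$\frac{d\mathbf{u}}{dt}=\mathbf{P}_\perp\mathbf{u}+\mathbf{P}_\parallel\mathbf{u},\qquad \mathbf{u}(0)=\mathbf{f}.$$ If $$\mathbf{v}^T\big((\mathbf{H}\mathbf{P}_\perp)+(\mathbf{H}\mathbf{P}_\perp)^T\big)\mathbf{v}\le0\quad\text{and}\quad \mathbf{v}^T\big((\mathbf{H}\mathbf{P}_\parallel)+(\mathbf{H}\mathbf{P}_\parallel)^T\big)\mathbf{v}\le0\qquad\text{for all }\mathbf{v}\in\mathbb{R}^N,$$ then $$\|\mathbf{u}(t)\|_H\le\|\mathbf{f}\|_H\quad\text{for all }t\ge0,\qquad\text{where }\|\mathbf{u}\|_H^2=\mathbf{u}^T\mathbf{H}\mathbf{u}.$$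
   Context: $H_x=\Delta x\,\mathrm{diag}(h_1,\dots,h_{n_x})$ and $H_y=\Delta y\,\mathrm{diag}(h_1,\dots,h_{n_y})$ are diagonal matrices with positive weights (the weights of the $x$- and $y$-operators may differ) and $\Delta x,\Delta y>0$; $\mathbf{H}=H_x\otimes H_y$. SBP operators: in each direction, with $n$ grid points, a (diagonal-norm, fully compatible) summation-by-parts pair consists of $D=H^{-1}Q$ with $Q+Q^T=B:=\mathrm{diag}(-1,0,\dots,0,1)$, and $D^{(\kappa)}_{2}=H^{-1}(-M^{(\kappa)}+B K D)$, $K=\mathrm{diag}(\kappa(x_1),\dots,\kappa(x_n))$, $M^{(\kappa)}=D^T(KH)D+R^{(\kappa)}$, with $R^{(\kappa)}$ symmetric positive semidefinite. Write $D_x,D_{xx}^{(\kappa_\perp)}$ and $D_y,D_{yy}^{(\kappa_\perp)}$ for these in the $x$ and $y$ directions with constant $\kappa_\perp>0$. Set $\mathbf{D}_x=D_x\otimes I_{n_y}$, $\mathbf{D}_{xx}^{(\kappa_\perp)}=D_{xx}^{(\kappa_\perp)}\otimes I_{n_y}$, $\mathbf{H}_x=H_x\otimes I_{n_y}$, $\mathbf{D}_y=I_{n_x}\otimes D_y$, $\mathbf{D}_{yy}^{(\kappa_\perp)}=I_{n_x}\otimes D_{yy}^{(\kappa_\perp)}$, $\mathbf{H}_y=I_{n_x}\otimes H_y$. Boundary operators: with $e_1,e_n$ the first and last standard unit vectors of the appropriate dimension, $\mathbf{B}_{1x}=e_1e_1^T\otimes I_{n_y}$, $\mathbf{B}_{n_x}=e_{n_x}e_{n_x}^T\otimes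 I_{n_y}$, $\mathbf{E}_{1y}=I_{n_x}\otimes(e_1e_1^T-e_1e_{n_y}^T)$, $\mathbf{E}_{n_y}=I_{n_x}\otimes(e_{n_y}e_{n_y}^T-e_{n_y}e_1^T)$. Perpendicular diffusion operator with zero boundary data (Dirichlet in $x$, periodic in $y$), with real penalty parameters $\tau_{x,0},\tau_{x,1},\tau_{y,0},\tau_{y,1},\tau_{y,2}$: $$\mathbf{P}_\perp=\mathbf{D}_{xx}^{(\kappa_\perp)}+\mathbf{D}_{yy}^{(\kappa_\perp)}+\tau_{x,0}\kappa_\perp\mathbf{H}_x^{-1}(\mathbf{B}_{n_x}-\mathbf{B}_{1x})\mathbf{H}_x^{-1}(\mathbf{B}_{n_x}-\mathbf{B}_{1x})+\tau_{x,1}\kappa_\perp\mathbf{H}_x^{-1}(\mathbf{H}_x\mathbf{D}_x)^T\mathbf{H}_x^{-1}(\mathbf{B}_{n_x}-\mathbf{B}_{1x})$$ $$+\tau_{y,0}\kappa_\perp\mathbf{H}_y^{-1}(\mathbf{E}_{1y}+\mathbf{E}_{n_y})+\tau_{y,1}\kappa_\perp\mathbf{H}_y^{-1}\mathbf{D}_y^T(\mathbf{E}_{1y}-\mathbf{E}_{n_y})+\tau_{y,2}\kappa_\perp\mathbf{H}_y^{-1}(\mathbf{E}_{1y}-\mathbf{E}_{n_y})\mathbf{D}_y .$$ Parallel diffusion operator: $\mathbf{P}_\parallel=-\tau_\parallel\kappa_\parallel\mathbf{H}^{-1}\big(\mathbf{I}-\tfrac12[\mathbf{P}_f+\mathbf{P}_b]\big)$,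 where $\mathbf{I}$ is the $N\times N$ identity, $\tau_\parallel>0$ and $\kappa_\parallel>0$ are scalars, and $\mathbf{P}_f,\mathbf{P}_b$ are $N\times N$ real matrices, each a product $\mathbf{\Pi}\,\mathbb{P}$ of an interpolation matrix $\mathbf{\Pi}$ and a permutation matrix $\mathbb{P}$. *)

(* Defs.v *)
From HB Require Import structures.
From mathcomp Require Import all_boot all_order all_algebra all_fingroup.
From mathcomp Require Import mxtens.
From mathcomp Require Import all_classical all_reals all_analysis.

Set Implicit Arguments.
Unset Strict Implicit.
Unset Printing Implicit Defensive.

Import Order.TTheory GRing.Theory Num.Theory.
Import numFieldNormedType.Exports.

Local Open Scope classical_set_scope.
Local Open Scope ring_scope.

(* Vectors of R^n are columns, a form v^T A v being the entry (0, 0) of the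
   1 x 1 matrix v^T *m A *m v.  A *t B is the Kronecker product: entry
   (i1 * p + i2, j1 * q + j2) is A i1 j1 * B i2 j2, for B of size p x q. *)
Definition quad (R : realType) (n : nat) (A : 'M[R]_n) (v : 'cV[R]_n) : R :=
  (v^T *m A *m v) 0 0.

Definition e_first (R : realType) (n : nat) : 'cV[R]_n :=
  \col_i (nat_of_ord i == 0%N)%:R.

Definition e_last (R : realType) (n : nat) : 'cV[R]_n :=
  \col_i ((nat_of_ord i).+1 == n)%:R.

Arguments e_first {R n}.
Arguments e_last {R n}.

Definition Bmx (R : realType) (n : nat) : 'M[R]_n :=
  diag_mx (\row_i (if (nat_of_ord i).+1 == n then 1
                   else if nat_of_ord i == 0%N then -1 else 0)).

Arguments Bmx {R n}.

(* [kappa] lists the values kappa(x_1), ..., kappa(x_n) on the grid; the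
   remainder [sbp_R] is the matrix R^(kappa) for these values. *)
Record sbp_operator (R : realType) (n : nat) (kappa : 'rV[R]_n) := SBPOperator {
  sbp_step : R;
  sbp_weight : 'rV[R]_n;
  sbp_Q : 'M[R]_n;
  sbp_R : 'M[R]_n;
  sbp_step_gt0 : 0 < sbp_step;
  sbp_weight_gt0 : forall i, 0 < sbp_weight 0 i;
  sbp_QE : sbp_Q + sbp_Q^T = Bmx;
  sbp_R_sym : sbp_R^T = sbp_R;
  sbp_R_psd : forall v, 0 <= quad sbp_R v
}.

Section SBP.
Variables (R : realType) (n : nat) (kappa : 'rV[R]_n) (S : sbp_operator kappa).

Definition sbp_H : 'M[R]_n := sbp_step S *: diag_mx (sbp_weight S).
Definition sbp_D : 'M[R]_n := invmx sbp_H *m sbp_Q S.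
Definition sbp_K : 'M[R]_n := diag_mx kappa.
Definition sbp_M : 'M[R]_n := sbp_D^T *m (sbp_K *m sbp_H) *m sbp_D + sbp_R S.
Definition sbp_D2 : 'M[R]_n := invmx sbp_H *m (- sbp_M + Bmx *m sbp_K *m sbp_D).

End SBP.

Section Semidiscrete.
Variables (R : realType) (nx ny : nat) (kperp : R).
Variables (Sx : sbp_operator (const_mx kperp : 'rV[R]_nx)).
Variables (Sy : sbp_operator (const_mx kperp : 'rV[R]_ny)).

Definition bigH : 'M[R]_(nx * ny) := sbp_H Sx *t sbp_H Sy.

Definition bigHx : 'M[R]_(nx * ny) := sbp_H Sx *t (1%:M : 'M[R]_ny).
Definition bigDx : 'M[R]_(nx * ny) := sbp_D Sx *t (1%:M : 'M[R]_ny).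
Definition bigDxx : 'M[R]_(nx * ny) := sbp_D2 Sx *t (1%:M : 'M[R]_ny).

Definition bigHy : 'M[R]_(nx * ny) := (1%:M : 'M[R]_nx) *t sbp_H Sy.
Definition bigDy : 'M[R]_(nx * ny) := (1%:M : 'M[R]_nx) *t sbp_D Sy.
Definition bigDyy : 'M[R]_(nx * ny) := (1%:M : 'M[R]_nx) *t sbp_D2 Sy.

Definition B1x : 'M[R]_(nx * ny) :=
  (e_first *m e_first^T : 'M[R]_nx) *t (1%:M : 'M[R]_ny).
Definition Bnx : 'M[R]_(nx * ny) :=
  (e_last *m e_last^T : 'M[R]_nx) *t (1%:M : 'M[R]_ny).
Definition E1y : 'M[R]_(nx * ny) :=
  (1%:M : 'M[R]_nx)
    *t (e_first *m e_first^T - e_first *m e_last^T : 'M[R]_ny).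
Definition Eny : 'M[R]_(nx * ny) :=
  (1%:M : 'M[R]_nx)
    *t (e_last *m e_last^T - e_last *m e_first^T : 'M[R]_ny).

Definition P_perp (taux0 taux1 tauy0 tauy1 tauy2 : R) : 'M[R]_(nx * ny) :=
  bigDxx + bigDyy
  + (taux0 * kperp) *:
      (invmx bigHx *m (Bnx - B1x) *m invmx bigHx *m (Bnx - B1x))
  + (taux1 * kperp) *:
      (invmx bigHx *m (bigHx *m bigDx)^T *m invmx bigHx *m (Bnx - B1x))
  + (tauy0 * kperp) *: (invmx bigHy *m (E1y + Eny))
  + (tauy1 * kperp) *: (invmx bigHy *m bigDy^T *m (E1y - Eny))
  + (tauy2 * kperp) *: (invmx bigHy *m (E1y - Eny) *m bigDy).

Definition P_par (taupar kpar : R) (Pf Pb : 'M[R]_(nx * ny)) :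
    'M[R]_(nx * ny) :=
  - (taupar * kpar) *: (invmx bigH *m (1%:M - 2^-1 *: (Pf + Pb))).

End Semidiscrete.

Definition normH (R : realType) (n : nat) (H : 'M[R]_n) (v : 'cV[R]_n) : R :=
  Num.sqrt (quad H v).

(* u is only constrained on [0, +oo[: its derivative is taken within that
   interval, hence is the ordinary derivative at t > 0 and the right derivative
   at t = 0. *)
Definition solves_on_halfline (R : realType) (n : nat) (A : 'M[R]_n)
    (f : 'cV[R]_n) (u : R -> 'cV[R]_n) : Prop :=
  u 0 = f /\
  forall t : R, 0 <= t ->
    (s - t)^-1 *: (u s - u t) @[s --> within [set s | 0 <= s] t^']
      --> A *m u t.

(* Main.v *)
(* The energy u^T H u has derivative u^T (H A + (H A)^T) u along u' = A u, H being
   symmetric; with A = P_perp + P_par the two hypotheses make it nonpositive. *)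
Require Import Defs.
From mathcomp Require Import all_boot all_order all_algebra all_fingroup.
From mathcomp Require Import mxtens.
From mathcomp Require Import all_classical all_reals all_analysis.
From mathcomp Require Import ring lra.

Import Order.TTheory GRing.Theory Num.Theory.
Import numFieldNormedType.Exports.
Local Open Scope classical_set_scope.
Local Open Scope ring_scope.

(** Energy method: the function E(t) = [quad H (u t)] is shown to be nonincreasing on [0, +oo[, and
    taking square roots gives the bound. For t > 0 the product rule, applied coordinatewise, gives
    E' ([is_derive_quad], via [quad_lyapunovE]). At t = 0 the right derivative of u yields right
    continuity of E ([cvg_at_right_quad]), so the monotonicity extends to the initial time. *)

Lemma is_derive_halfline (R : realType) (x : R -> R) (t l : R) : 0 < t ->
  (s - t)^-1 * (x s - x t) @[s --> within [set s | 0 <= s] t^'] --> l ->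
  is_derive t 1 x l.
Proof.
move=> t0 xl.
suff hl : h^-1 *: ((x \o shift t) (h *: 1) - x t) @[h --> 0^'] --> l.
  apply: DeriveDef; first by apply/cvg_ex; exists l.
  exact: cvg_lim hl.
have shiftt : h + t @[h --> 0^'] --> within [set s : R | 0 <= s] t^'.
  move=> P /nbhs_ballP[e /= e0 eP].
  (* Capping the radius by t keeps [h + t] nonnegative, so near t > 0 the restriction to the
     half-line has no effect. *)
  apply/nbhs_ballP; exists (Num.min e t); first by rewrite /= lt_min e0.
  move=> h /=; rewrite /ball/= sub0r normrN lt_min => /andP[he ht] h0.
  apply: eP => /=.
  - by rewrite /ball/= opprD addrCA subrr addr0 normrN.
  - by rewrite -subr_eq0 addrK.
  - by have := ler_norm (- h); rewrite normrN; lra.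
apply: cvg_trans (cvg_comp _ _ shiftt xl); apply: near_eq_cvg.
by near=> h; rewrite /= addrK [h *: 1]mulr1.
Unshelve. all: by end_near. Qed.

(** For s > 0, [x s] is [x 0] plus s times the difference quotient, and this product tends to 0 * l
    = 0. *)
Lemma cvg_at_right_halfline (R : realType) (x : R -> R) (l : R) :
  (s - 0)^-1 * (x s - x 0) @[s --> within [set s | 0 <= s] (0 : R)^'] --> l ->
  x s @[s --> 0^'+] --> x 0.
Proof.
move=> xl.
have {}xl : s^-1 * (x s - x 0) @[s --> 0^'+] --> l.
  apply: cvg_trans xl => P /nbhs_ballP[e /= e0 eP].
  apply/nbhs_ballP; exists e => //= s se s0.
  have := eP s se; rewrite /= subr0 => /(_ _ _); apply; last exact: ltW.
  by rewrite gt_eqF.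
have s0 : (s : R) @[s --> 0^'+] --> (0 : R) by apply: cvg_at_right_filter.
have xs : x 0 + s * (s^-1 * (x s - x 0)) @[s --> 0^'+] --> x 0.
  rewrite -[X in _ --> X]addr0 -[X in _ + X](mul0r l).
  by apply: cvgD; [exact: cvg_cst|exact: cvgM].
apply: (cvg_trans _ xs); apply: near_eq_cvg; near=> s.
by rewrite /= mulVKf ?subrKC// gt_eqF.
Unshelve. all: by end_near. Qed.

Lemma solves_on_halfline_coord (R : realType) (n : nat) (A : 'M[R]_n)
    (f : 'cV[R]_n) (u : R -> 'cV[R]_n) (i : 'I_n) (t : R) :
  solves_on_halfline A f u -> 0 <= t ->
  (s - t)^-1 * (u s i 0 - u t i 0) @[s --> within [set s | 0 <= s] t^']
    --> (A *m u t) i 0.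
Proof.
case=> _ uA t0; have := uA t t0 => ut.
have uti := cvg_comp _ _ ut (@coord_continuous _ _ _ i 0 (A *m u t)).
by apply: (cvg_trans _ uti); apply: near_eq_cvg; near=> s; rewrite /= !mxE.
Unshelve. all: by end_near. Qed.

Lemma quadE (R : realType) (n : nat) (H : 'M[R]_n) (v : 'cV[R]_n) :
  quad H v = \sum_(i < n) \sum_(j < n) H i j * (v i 0 * v j 0).
Proof.
rewrite /quad mxE exchange_big /=; apply: eq_bigr => j _.
rewrite mxE mulr_suml; apply: eq_bigr => i _; rewrite !mxE; ring.
Qed.

Lemma quadD (R : realType) (n : nat) (A B : 'M[R]_n) (v : 'cV[R]_n) :
  quad (A + B) v = quad A v + quad B v.
Proof. by rewrite /quad mulmxDr mulmxDl mxE. Qed.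

(** The right-hand side is what the product rule gives termwise on [quadE] when v has derivative
    [A *m v]. A scalar equals its transpose, so by symmetry of H the left-hand side is twice v^T H
    (A v). *)
Lemma quad_lyapunovE (R : realType) (n : nat) (H A : 'M[R]_n) (v : 'cV[R]_n) :
  H^T = H ->
  quad (H *m A + (H *m A)^T) v =
  \sum_(i < n) \sum_(j < n)
    H i j * (v i 0 * (A *m v) j 0 + v j 0 * (A *m v) i 0).
Proof.
move=> Hsym; pose w := A *m v.
have vHw : (v^T *m H *m w) 0 0 = \sum_(i < n) \sum_(j < n) H i j * (v i 0 * w j 0).
  rewrite mxE exchange_big /=; apply: eq_bigr => j _.
  rewrite mxE mulr_suml; apply: eq_bigr => i _; rewrite !mxE; ring.
have -> : quad (H *m A + (H *m A)^T) v = (v^T *m H *m w) 0 0 *+ 2.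
  rewrite quadD mulr2n /quad; congr (_ + _); first by rewrite !mulmxA.
  transitivity ((v^T *m (H *m A)^T *m v)^T 0 0); first by rewrite [RHS]mxE.
  by rewrite !trmx_mul !trmxK !mulmxA.
(* The indices are swapped in one of the two copies, and [H j i = H i j] lets them be added
   termwise. *)
rewrite mulr2n {2}vHw exchange_big /= vHw -big_split /=; apply: eq_bigr => i _.
rewrite -big_split /=; apply: eq_bigr => j _.
have -> : H j i = H i j by rewrite -{1}Hsym mxE.
by rewrite mulrDr.
Qed.

Section Energy.
Variables (R : realType) (n : nat) (H A : 'M[R]_n).
Variables (f : 'cV[R]_n) (u : R -> 'cV[R]_n).
Hypothesis Hsym : H^T = H.
Hypothesis uA : solves_on_halfline A f u.

Lemma is_derive_quad (t : R) : 0 < t ->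
  is_derive t 1 (fun s => quad H (u s)) (quad (H *m A + (H *m A)^T) (u t)).
Proof.
move=> t0.
have du i : is_derive t 1 (fun s => u s i 0) ((A *m u t) i 0).
  apply: is_derive_halfline => //.
  exact: solves_on_halfline_coord uA (ltW t0).
(* Written as a sum of products of functions, the energy can be differentiated by the sum and
   product rules. *)
have -> : (fun s => quad H (u s)) = \sum_(i < n) \sum_(j < n)
    (cst (H i j) * ((fun s => u s i 0) * (fun s => u s j 0))).
  apply/funext => s; rewrite quadE fct_sumE; apply: eq_bigr => i _.
  by rewrite fct_sumE.
rewrite quad_lyapunovE//.
apply: is_derive_sum => i; apply: is_derive_sum => j.
apply: is_derive_eq.
(* The vanishing term comes from the constant factor [H i j]. *)
by rewrite scaler0 addr0.
Qed.

Lemma cvg_at_right_quad : quad H (u s) @[s --> 0^'+] --> quad H (u 0).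
Proof.
have cu i : u s i 0 @[s --> 0^'+] --> u 0 i 0.
  apply: cvg_at_right_halfline.
  exact: solves_on_halfline_coord uA (lexx 0).
rewrite quadE; under eq_fun do rewrite quadE.
apply: cvg_big => [|i _]; first exact: add_continuous.
apply: cvg_big => [|j _]; first exact: add_continuous.
apply: cvgM; first exact: cvg_cst.
exact: cvgM.
Qed.

Lemma normH_le_initial :
  (forall v, quad (H *m A + (H *m A)^T) v <= 0) ->
  forall t, 0 <= t -> normH H (u t) <= normH H f.
Proof.
move=> HA t t0; rewrite -uA.1; apply: ler_wsqrtr.
pose E s := quad H (u s).
(* The three goals are derivability and sign of the derivative on the open half-line, then
   continuity up to 0. *)
apply: (@ler0_derive1_nincry _ E 0) => //.
- by move=> s; rewrite in_itv/= andbT => /is_derive_quad[].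
- move=> s; rewrite in_itv/= andbT => /is_derive_quad sE.
  by rewrite derive1E derive_val.
- apply/continuous_within_itvcyP; split; last exact: cvg_at_right_quad.
  move=> s; rewrite in_itv/= andbT => /is_derive_quad[dE _].
  by apply/differentiable_continuous/derivable1_diffP.
Qed.

End Energy.

Lemma bigH_sym (R : realType) (nx ny : nat) (kperp : R)
    (Sx : sbp_operator (const_mx kperp : 'rV[R]_nx))
    (Sy : sbp_operator (const_mx kperp : 'rV[R]_ny)) :
  (bigH Sx Sy)^T = bigH Sx Sy.
Proof. by rewrite /bigH trmx_tens /sbp_H !linearZ/= !tr_diag_mx. Qed.

Theorem theorem3p4 (R : realType) (nx ny : nat) (hnx : (2 <= nx)%N)
    (hny : (2 <= ny)%N)
    (kperp : R) (hkperp : 0 < kperp)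
    (Sx : sbp_operator (const_mx kperp : 'rV[R]_nx))
    (Sy : sbp_operator (const_mx kperp : 'rV[R]_ny))
    (taux0 taux1 tauy0 tauy1 tauy2 : R)
    (taupar kpar : R) (htaupar : 0 < taupar) (hkpar : 0 < kpar)
    (Pif Pib : 'M[R]_(nx * ny)) (sf sb : 'S_(nx * ny))
    (f : 'cV[R]_(nx * ny)) (u : R -> 'cV[R]_(nx * ny)) :
  let H := bigH Sx Sy in
  let Pperp := P_perp Sx Sy taux0 taux1 tauy0 tauy1 tauy2 in
  let Ppar := P_par Sx Sy taupar kpar
                (Pif *m perm_mx sf) (Pib *m perm_mx sb) in
  solves_on_halfline (Pperp + Ppar) f u ->
  (forall v : 'cV[R]_(nx * ny), quad (H *m Pperp + (H *m Pperp)^T) v <= 0) ->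
  (forall v : 'cV[R]_(nx * ny), quad (H *m Ppar + (H *m Ppar)^T) v <= 0) ->
  forall t : R, 0 <= t -> normH H (u t) <= normH H f.
Proof.
move=> H Pperp Ppar uP Hperp Hpar.
apply: (normH_le_initial _ _ _ _ _ _ _ uP); first exact: bigH_sym.
(* The form is additive in the operator, so it splits into the perpendicular and parallel forms,
   each nonpositive. *)
move=> v; rewrite mulmxDr [(_ + _)^T]linearD addrACA quadD.
by rewrite -[leRHS]addr0 lerD.
Qed.
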